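(* Let $M$ be a compact topological manifold (possibly with boundary), endowed with a metric $d$ compatible with its topology. Then the set of maps $f\in C(M)$ which exhibit distributional chaos of type 1 (DC1) is dense in $C(M)$ with respect to the metric $d_{C^0}(f,g)=\sup_{x\in M}d(f(x),g(x))$.
   Context: $C(M)$ denotes the space of continuous self-maps of $M$. For a continuous map $f:X\to X$ of a compact metric space $(X,d)$, a pair $(x,y)\in X^2$ is a DC1-pair for $f$ if $\limsup_{n\to\infty}\frac1n|\{0\le i\le n-1: d(f^i(x),f^i(y))<\delta\}|=1$ for every $\delta>0$, and $\limsup_{n\to\infty}\frac1n|\{0\le i\le n-1: d(f^i(x),f^i(y))>\delta_0\}|=1$ for some $\delta_0>0$. The map $f$ exhibits DC1 if there is an uncountable set $S\subset X$ such that every pair $(x,y)$ with $x,y\in S$, $x\ne y$, is a DC1-pair for $f$.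
   Formalization: The manifold M is assumed nonempty and of (fixed) dimension at least 1; for empty or zero-dimensional (finite) M no map exhibits DC1, so the claim as worded fails there. *)

(* Defs.v *)
From Stdlib Require Import Reals Lra Lia.
Open Scope R_scope.

Definition is_metric {X : Type} (d : X -> X -> R) : Prop :=
  (forall x y, 0 <= d x y) /\
  (forall x y, d x y = 0 <-> x = y) /\
  (forall x y, d x y = d y x) /\
  (forall x y z, d x z <= d x y + d y z).

Definition open_set {X : Type} (d : X -> X -> R) (U : X -> Prop) : Prop :=
  forall x, U x -> exists r, 0 < r /\ forall y, d x y < r -> U y.

Definition compact_space {X : Type} (d : X -> X -> R) : Prop :=
  forall (I : Type) (U : I -> X -> Prop),
    (forall i, open_set d (U i)) ->
    (forall x, exists i, U i x) ->
    exists l : list I, forall x, exists i, List.In i l /\ U i x.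

(** Euclidean half-space H^n = { v in R^n | v_0 >= 0 }, with R^n encoded as
    sequences nat -> R vanishing at coordinates >= n. *)
Definition in_halfspace (n : nat) (v : nat -> R) : Prop :=
  (forall i, (n <= i)%nat -> v i = 0) /\ 0 <= v 0%nat.

Definition near (n : nat) (e : R) (v w : nat -> R) : Prop :=
  forall i, (i < n)%nat -> Rabs (w i - v i) < e.

Definition open_in_halfspace (n : nat) (V : (nat -> R) -> Prop) : Prop :=
  (forall v, V v -> in_halfspace n v) /\
  forall v, V v -> exists e, 0 < e /\
     forall w, in_halfspace n w -> near n e v w -> V w.

Definition chart_at {X : Type} (d : X -> X -> R) (n : nat) (x : X) : Prop :=
  exists (U : X -> Prop) (V : (nat -> R) -> Prop)
         (phi : X -> nat -> R) (psi : (nat -> R) -> X),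
    open_set d U /\ U x /\ open_in_halfspace n V /\
    (forall y, U y -> V (phi y)) /\
    (forall v, V v -> U (psi v)) /\
    (forall y, U y -> psi (phi y) = y) /\
    (forall v, V v -> phi (psi v) = v) /\
    (forall y, U y -> forall e, 0 < e -> exists del, 0 < del /\
        forall z, U z -> d y z < del -> near n e (phi y) (phi z)) /\
    (forall v, V v -> forall e, 0 < e -> exists del, 0 < del /\
        forall w, V w -> near n del v w -> d (psi v) (psi w) < e).

Definition is_manifold {X : Type} (d : X -> X -> R) (n : nat) : Prop :=
  forall x, chart_at d n x.

Definition continuous_map {X : Type} (d : X -> X -> R) (f : X -> X) : Prop :=
  forall x e, 0 < e -> exists del, 0 < del /\ forall y, d x y < del -> d (f x) (f y) < e.

Definition is_dC0 {X : Type} (d : X -> X -> R) (f g : X -> X) (s : R) : Prop :=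
  is_lub (fun r => exists x, r = d (f x) (g x)) s.

Fixpoint iter {X : Type} (f : X -> X) (i : nat) (x : X) : X :=
  match i with O => x | S k => f (iter f k x) end.

Fixpoint count_below (P : nat -> bool) (n : nat) : nat :=
  match n with O => O | S k => (count_below P k + if P k then 1 else 0)%nat end.

Definition Rltb (a b : R) : bool := if Rlt_dec a b then true else false.

(** l = limsup_{n -> oo} u n  (for sequences bounded above, as here) *)
Definition is_limsup (u : nat -> R) (l : R) : Prop :=
  forall e, 0 < e ->
    (exists N, forall n, (N <= n)%nat -> u n < l + e) /\
    (forall N, exists n, (N <= n)%nat /\ l - e < u n).

(** (1/n) |{0 <= i <= n-1 : d(f^i x, f^i y) < delta}|  (n >= 1; value at n = 0
    irrelevant for the limsup) *)
Definition freq_close {X : Type} (d : X -> X -> R) (f : X -> X) (x y : X)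
  (delta : R) (n : nat) : R :=
  INR (count_below (fun i => Rltb (d (iter f i x) (iter f i y)) delta) n) / INR n.

Definition freq_far {X : Type} (d : X -> X -> R) (f : X -> X) (x y : X)
  (delta : R) (n : nat) : R :=
  INR (count_below (fun i => Rltb delta (d (iter f i x) (iter f i y))) n) / INR n.

Definition DC1_pair {X : Type} (d : X -> X -> R) (f : X -> X) (x y : X) : Prop :=
  (forall delta, 0 < delta -> is_limsup (freq_close d f x y delta) 1) /\
  (exists delta0, 0 < delta0 /\ is_limsup (freq_far d f x y delta0) 1).

Definition countable_set {X : Type} (S : X -> Prop) : Prop :=
  exists g : X -> nat, forall x y, S x -> S y -> g x = g y -> x = y.

Definition exhibits_DC1 {X : Type} (d : X -> X -> R) (f : X -> X) : Prop :=
  exists S : X -> Prop, ~ countable_set S /\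
    forall x y, S x -> S y -> x <> y -> DC1_pair d f x y.

(* Main.v *)
(** A point z accumulated by an orbit of f gives a finite orbit x_0, ..., x_{k-1} of
    distinct points, with x_0 and f(x_{k-1}) in one small chart ball around z.  Choose a
    small arc a_i starting at each x_i, with a continuous coordinate T_i near x_i that
    inverts a_i.  Replacing f near x_i by a_{i+1} o T_i, and near x_{k-1} by a_0 o F o T_{k-1}
    for an interval map F containing a full shift, is a C^0-small change, glued to f along
    straight chart segments; the new map g satisfies g^k = F on a_0.  A coded point whose
    itinerary consists of constant blocks of superexponentially growing length spends
    almost all of the time up to the end of a long 0-block (1-block) near the g-orbit of
    a_0(0) (of a_0(1)), and these two periodic orbits stay apart at all times.  Letting
    the blocks list every bit of a binary sequence infinitely often yields an uncountable
    DC1 set. *)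

Require Import Defs.
From Stdlib Require Import Reals Lra Lia List Arith Classical ClassicalEpsilon
  IndefiniteDescription FunctionalExtensionality Cantor.
From Coquelicot Require Import Hierarchy Series.
Open Scope R_scope.

(** * Finite minima and compactness *)

(** Serves to shrink finitely many radii to a common one; the first hypothesis says that a smaller
    radius stays admissible. *)
Lemma finite_pos (P : nat -> R -> Prop) (k : nat) :
  (forall i r r', P i r -> 0 < r' -> r' <= r -> P i r') ->
  (forall i, (i < k)%nat -> exists r, 0 < r /\ P i r) ->
  exists r, 0 < r /\ forall i, (i < k)%nat -> P i r.
Proof.
  intros mono; induction k as [|k IH]; intros H.
  - exists 1; split; [lra | intros; lia].
  - destruct IH as [r [r0 Hr]]; [intros; apply H; lia|].
    destruct (H k) as [r' [r0' Hr']]; [lia|].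
    exists (Rmin r r'); split; [now apply Rmin_pos|].
    intros i Hi; destruct (Nat.eq_dec i k) as [->|].
    + apply (mono _ r'); auto using Rmin_r, Rmin_pos.
    + apply (mono _ r); auto using Rmin_l, Rmin_pos; apply Hr; lia.
Qed.

(** Otherwise every point has a ball that the sequence avoids from some index [N] on. The open sets
    so attached to each [N] cover the space, and a finite subcover misses any term whose index
    dominates all its [N]. *)
Lemma orbit_cluster_point {X : Type} (d : X -> X -> R) (u : nat -> X) :
  is_metric d -> compact_space d ->
  exists z, forall e, 0 < e -> forall N, exists n, (N <= n)%nat /\ d z (u n) < e.
Proof.
  intros [pos [zero [sym tri]]] cpt; apply NNPP; intros H.
  destruct (cpt nat (fun N y => exists z e, 0 < e /\ d z y < e /\
     forall n, (N <= n)%nat -> e <= d z (u n))) as [l Hl].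
  - intros N y [z [e [e0 [Hy Hn]]]].
    exists (e - d z y); split; [lra|].
    intros y' Hy'; exists z, e; repeat split; auto.
    specialize (tri z y y'); lra.
  - intros z; apply NNPP; intros Hz; apply H; exists z; intros e e0 N.
    apply NNPP; intros HN; apply Hz; exists N, z, e.
    rewrite (proj2 (zero z z) eq_refl); repeat split; auto.
    intros n Hn; destruct (Rle_lt_dec e (d z (u n))); auto.
    exfalso; apply HN; now exists n.
  - destruct (Hl (u (list_max l))) as [N [HN [z [e [_ [Hlt Hge]]]]]].
    assert (N <= list_max l)%nat.
    { pose proof (proj1 (list_max_le l (list_max l)) (le_n _)) as HF.
      rewrite Forall_forall in HF; now apply HF. }
    specialize (Hge _ H0); lra.
Qed.

(** * Distributional chaos from a coded subsystem *)

Lemma iter_add {X : Type} (f : X -> X) (i j : nat) (x : X) :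
  iter f (i + j) x = iter f i (iter f j x).
Proof. induction i; simpl; congruence. Qed.

Lemma continuous_iter {X : Type} (d : X -> X -> R) (f : X -> X) (i : nat) :
  continuous_map d f -> continuous_map d (iter f i).
Proof.
  intros cf; induction i as [|i IH]; intros x e e0; simpl.
  - now exists e.
  - destruct (cf (iter f i x) e e0) as [e' [e0' He']].
    destruct (IH x e' e0') as [del [del0 Hdel]]; exists del; auto.
Qed.

Lemma iter_mul_periodic {X : Type} (f : X -> X) (k i : nat) (p : X) :
  iter f k p = p -> iter f (i * k) p = p.
Proof.
  intros H; induction i as [|i IH]; simpl; auto.
  now rewrite iter_add, IH.
Qed.

Lemma iter_mod_periodic {X : Type} (f : X -> X) (k j : nat) (p : X) :
  (1 <= k)%nat -> iter f k p = p -> iter f j p = iter f (j mod k) p.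
Proof.
  intros Hk H; rewrite (Nat.div_mod_eq j k) at 1.
  rewrite Nat.add_comm, iter_add; f_equal.
  rewrite Nat.mul_comm; now apply iter_mul_periodic.
Qed.

Definition shift (i : nat) (s : nat -> bool) : nat -> bool := fun l => s (i + l)%nat.

Lemma iter_mul_coded {X : Type} (f : X -> X) (k : nat) (tau : (nat -> bool) -> X) :
  (forall s, iter f k (tau s) = tau (shift 1 s)) ->
  forall i s, iter f (i * k) (tau s) = tau (shift i s).
Proof.
  intros H i; induction i as [|i IH]; intros s; [reflexivity|].
  replace (S i * k)%nat with (k + i * k)%nat by lia.
  rewrite iter_add, IH, H; f_equal; unfold shift.
  apply functional_extensionality; intros l; f_equal; lia.
Qed.

(** Split [j] as [(j / k) * k + j mod k]. The multiple of [k] shifts the word, whose point is then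
    near [p]; fewer than [k] iterates remain, and continuity at [p] controls them all at once. Hence
    [K] depends on neither [s] nor [j]. *)
Lemma coded_tracking {X : Type} (d : X -> X -> R) (f : X -> X) (k : nat)
  (tau : (nat -> bool) -> X) (p : X) (b : bool) :
  continuous_map d f -> (1 <= k)%nat -> iter f k p = p ->
  (forall s, iter f k (tau s) = tau (shift 1 s)) ->
  (forall e, 0 < e -> exists K, forall s,
      (forall l, (l < K)%nat -> s l = b) -> d p (tau s) < e) ->
  forall e, 0 < e -> exists K, forall s j,
    (forall l, (l < K)%nat -> s (j / k + l)%nat = b) ->
    d (iter f j p) (iter f j (tau s)) < e.
Proof.
  intros cf Hk Hp Htau Hb e e0.
  destruct (finite_pos (fun i r => forall y, d p y < r -> d (iter f i p) (iter f i y) < e) k)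
    as [r [r0 Hr]].
  - intros i r r' H _ Hle y Hy; apply H; lra.
  - intros i _; destruct (continuous_iter d f i cf p e e0) as [r Hr]; now exists r.
  - destruct (Hb r r0) as [K HK]; exists K; intros s j Hs.
    rewrite (iter_mod_periodic f k j p) by assumption.
    replace (iter f j (tau s)) with (iter f (j mod k) (tau (shift (j / k) s))).
    + apply Hr; [apply Nat.mod_upper_bound; lia|]; now apply HK.
    + rewrite <- (iter_mul_coded f k tau Htau), <- iter_add; f_equal.
      rewrite (Nat.div_mod_eq j k) at 3; lia.
Qed.

(** Orbits meeting at a time [i < k] would give [p = q] after [k - i] further iterates, so the
    minimal distance over one period is positive. *)
Lemma periodic_orbits_apart {X : Type} (d : X -> X -> R) (f : X -> X) (k : nat) (p q : X) :
  is_metric d -> (1 <= k)%nat -> iter f k p = p -> iter f k q = q -> p <> q ->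
  exists r, 0 < r /\ forall j, r <= d (iter f j p) (iter f j q).
Proof.
  intros [pos [zero [sym tri]]] Hk Hp Hq Hpq.
  destruct (finite_pos (fun i r => r <= d (iter f i p) (iter f i q)) k) as [r [r0 Hr]].
  - intros; lra.
  - intros i Hi; exists (d (iter f i p) (iter f i q)); split; [|lra].
    destruct (pos (iter f i p) (iter f i q)) as [|E]; [assumption|].
    exfalso; apply Hpq; symmetry in E; apply zero in E.
    apply (f_equal (iter f (k - i))) in E; rewrite <- !iter_add in E.
    replace (k - i + i)%nat with k in E by lia; congruence.
  - exists r; split; auto; intros j.
    rewrite (iter_mod_periodic f k j p), (iter_mod_periodic f k j q) by assumption.
    apply Hr, Nat.mod_upper_bound; lia.
Qed.

Lemma count_below_le (P : nat -> bool) (n : nat) : (count_below P n <= n)%nat.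
Proof. induction n; simpl; [|destruct (P n)]; lia. Qed.

Lemma count_below_interval (P : nat -> bool) (a n : nat) :
  (forall j, (a <= j < n)%nat -> P j = true) -> (n <= count_below P n + a)%nat.
Proof.
  induction n as [|n IH]; intros H; simpl; [lia|].
  destruct (le_lt_dec a n) as [Hn|Hn].
  - rewrite H by lia; assert (n <= count_below P n + a)%nat by (apply IH; intros; apply H; lia); lia.
  - lia.
Qed.

(** A window [[a, n)] of good times gives frequency at least [1 - a / n], and [a / n] can be made
    arbitrarily small. *)
Lemma limsup_count_one (P : nat -> bool) :
  (forall M, exists a n, (M <= n)%nat /\ (M * a <= n)%nat /\
     forall j, (a <= j < n)%nat -> P j = true) ->
  is_limsup (fun n => INR (count_below P n) / INR n) 1.
Proof.
  intros H e e0; split.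
  - exists 1%nat; intros n Hn; apply le_INR in Hn; simpl in Hn.
    pose proof (le_INR _ _ (count_below_le P n)).
    apply Rle_lt_trans with 1; [|lra].
    apply Rmult_le_reg_r with (INR n); [lra|].
    unfold Rdiv; rewrite Rmult_assoc, Rinv_l by lra; lra.
  - intros N; destruct (INR_unbounded (/ e)) as [M0 HM0].
    (* [N] makes [n] large enough, [M0 > / e] forces [a < e * n], and the [1] makes [n] positive. *)
    destruct (H (N + M0 + 1)%nat) as [a [n [H1 [H2 H3]]]].
    exists n; split; [lia|].
    pose proof (le_INR _ _ (count_below_interval P a n H3)) as Hc.
    rewrite plus_INR in Hc; apply le_INR in H1, H2.
    rewrite mult_INR, !plus_INR in H2; rewrite !plus_INR in H1; simpl in H1, H2.
    pose proof (pos_INR N); pose proof (pos_INR a); pose proof (pos_INR M0).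
    assert (0 < INR n) by lra.
    apply Rmult_lt_reg_r with (INR n); [lra|].
    unfold Rdiv; rewrite Rmult_assoc, Rinv_l by lra.
    assert (INR a < e * INR n); [|lra].
    destruct (Req_dec (INR a) 0) as [->|Ha].
    + rewrite <- (Rmult_0_l 0); apply Rmult_le_0_lt_compat; lra.
    + assert (1 < e * INR M0).
      { apply Rmult_lt_reg_l with (/ e); [now apply Rinv_0_lt_compat|].
        rewrite <- Rmult_assoc, Rinv_l by lra; lra. }
      assert (INR M0 * INR a <= INR n) by nra.
      apply Rlt_le_trans with (e * (INR M0 * INR a)); nra.
Qed.

(* The double exponential makes each block [2^2^m, 2^2^(m+1)) overwhelm all the
   previous ones, and the first projection of Cantor's pairing makes every
   symbol rule occur in infinitely many blocks. *)
Definition block_word (al : nat -> bool) (i : nat) : bool :=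
  match fst (Cantor.of_nat (Nat.log2 (Nat.log2 i))) with
  | O => false
  | S c => al c
  end.

(** The block index is the code of the pair [(c, M + K)]: the first component selects the rule, the
    second makes the index at least [M + K]. Then [B = A * A] with [A > M + K]. *)
Lemma long_constant_block (c M K : nat) :
  exists A B, (0 < A)%nat /\ (M * A + K <= B)%nat /\ forall i, (A <= i < B)%nat ->
    fst (Cantor.of_nat (Nat.log2 (Nat.log2 i))) = c.
Proof.
  set (m := Cantor.to_nat (c, (M + K)%nat)).
  pose proof (Cantor.to_nat_non_decreasing c (M + K)) as Hm; fold m in Hm.
  exists (2 ^ 2 ^ m)%nat, (2 ^ 2 ^ S m)%nat.
  assert (H1 := Nat.pow_gt_lin_r 2 m ltac:(lia)).
  assert (H2 := Nat.pow_gt_lin_r 2 (2 ^ m) ltac:(lia)).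
  split; [lia|split].
  - replace (2 ^ S m)%nat with (2 ^ m + 2 ^ m)%nat by (simpl; lia).
    rewrite Nat.pow_add_r; clearbody m.
    generalize dependent (2 ^ 2 ^ m)%nat; intros A ?; nia.
  - intros i [Hi1 Hi2].
    assert (Nat.log2 (Nat.log2 i) = m) as ->.
    + apply Nat.log2_unique; [lia|split].
      * apply (proj1 (Nat.log2_le_pow2 i (2 ^ m) ltac:(lia))); lia.
      * apply (proj1 (Nat.log2_lt_pow2 i (2 ^ S m) ltac:(lia))); lia.
    + unfold m; now rewrite Cantor.cancel_of_to.
Qed.

(** Time [j] reads the word from position [j / k], so positions [[A, B)] become times from [k * A]
    on. Stopping at [k * (B - K)] keeps the window of [K] symbols inside the block. *)
Lemma block_word_limsup (k c K : nat) (P : nat -> bool) :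
  (1 <= k)%nat ->
  (forall j, (forall l, (l < K)%nat ->
      fst (Cantor.of_nat (Nat.log2 (Nat.log2 (j / k + l)))) = c) -> P j = true) ->
  is_limsup (fun n => INR (count_below P n) / INR n) 1.
Proof.
  intros Hk H; apply limsup_count_one; intros M.
  destruct (long_constant_block c M K) as [A [B [HA [HB Hc]]]].
  exists (k * A)%nat, (k * (B - K))%nat; repeat split; try nia.
  intros j [H1 H2]; apply H; intros l Hl; apply Hc.
  assert (A <= j / k)%nat by (apply Nat.div_le_lower_bound; lia).
  assert (j / k < B - K)%nat by (apply Nat.Div0.div_lt_upper_bound; lia).
  lia.
Qed.

Lemma Rltb_true (a b : R) : a < b -> Rltb a b = true.
Proof. unfold Rltb; destruct (Rlt_dec a b); tauto. Qed.

(** A point never gets far from itself, so its far frequency is 0. Injectivity of the coding will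
    follow from this. *)
Lemma DC1_pair_neq {X : Type} (d : X -> X -> R) (f : X -> X) (x y : X) :
  is_metric d -> DC1_pair d f x y -> x <> y.
Proof.
  intros [_ [zero _]] [_ [r [r0 H]]] <-.
  destruct (H (1/2) ltac:(lra)) as [_ H2]; destruct (H2 0%nat) as [n [_ Hn]].
  unfold freq_far in Hn.
  replace (count_below _ n) with 0%nat in Hn; [unfold Rdiv in Hn; simpl in Hn; lra|].
  clear Hn; induction n as [|n IH]; simpl; [reflexivity|].
  rewrite <- IH, (proj2 (zero _ _) eq_refl).
  unfold Rltb; destruct (Rlt_dec r 0); [lra|reflexivity].
Qed.

(** [D] is true at [m] when some sequence coded by [m] is false there. Were [D] false at its own
    code, [D] would be a witness; as it is true, injectivity identifies the witness with [D], a
    contradiction. *)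
Lemma cantor_diagonal (code : (nat -> bool) -> nat) :
  ~ (forall al be, code al = code be -> al = be).
Proof.
  intros inj.
  set (D := fun m => if excluded_middle_informative
                          (exists al, code al = m /\ al m = false) then true else false).
  assert (HD : D (code D) = true).
  { unfold D at 1; destruct excluded_middle_informative as [|n]; auto.
    destruct (D (code D)) eqn:E; [|exfalso; eauto].
    revert E; unfold D at 1; destruct excluded_middle_informative; [contradiction|discriminate]. }
  pose proof HD as HD'; unfold D at 1 in HD'.
  destruct excluded_middle_informative as [[al [E1 E2]]|]; [|discriminate].
  apply inj in E1; congruence.
Qed.

Lemma block_word_DC1 {X : Type} (d : X -> X -> R) (f : X -> X) (k : nat)
  (tau : (nat -> bool) -> X) (p q : X) :
  is_metric d -> continuous_map d f -> (1 <= k)%nat ->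
  iter f k p = p -> iter f k q = q -> p <> q ->
  (forall s, iter f k (tau s) = tau (shift 1 s)) ->
  (forall e, 0 < e -> exists K, forall s,
      (forall l, (l < K)%nat -> s l = false) -> d p (tau s) < e) ->
  (forall e, 0 < e -> exists K, forall s,
      (forall l, (l < K)%nat -> s l = true) -> d q (tau s) < e) ->
  forall al be, al <> be -> DC1_pair d f (tau (block_word al)) (tau (block_word be)).
Proof.
  intros Hd cf Hk Hp Hq Hpq Htau Hfalse Htrue.
  assert (Tp := coded_tracking d f k tau p false cf Hk Hp Htau Hfalse).
  assert (Tq := coded_tracking d f k tau q true cf Hk Hq Htau Htrue).
  destruct (periodic_orbits_apart d f k p q Hd Hk Hp Hq Hpq) as [r [r0 Hr]].
  destruct Hd as [pos [zero [sym tri]]].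
  intros al be Hab; split.
  - intros e e0; destruct (Tp (e / 2)) as [K HK]; [lra|].
    (* In blocks of rule [0] every word reads [false], so both points follow the orbit of [p]. *)
    apply (block_word_limsup k 0 K); auto; intros j Hj; apply Rltb_true.
    set (u := iter f j (tau (block_word al))); set (v := iter f j (tau (block_word be))).
    assert (d (iter f j p) u < e / 2).
    { apply HK; intros l Hl; unfold block_word; now rewrite Hj. }
    assert (d (iter f j p) v < e / 2).
    { apply HK; intros l Hl; unfold block_word; now rewrite Hj. }
    specialize (tri u (iter f j p) v); rewrite (sym u (iter f j p)) in tri; lra.
  (* Two tracking errors below [r / 3] leave more than [r / 3] of the gap [r] between the periodic
     orbits. *)
  - exists (r / 3); split; [lra|].
    assert (exists c, al c <> be c) as [c Hc].
    { apply NNPP; intros H; apply Hab, functional_extensionality; intros c.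
      apply NNPP; intros Hc; apply H; now exists c. }
    destruct (Tp (r / 3)) as [K1 HK1]; [lra|].
    destruct (Tq (r / 3)) as [K2 HK2]; [lra|].
    (* In blocks of rule [S c] the words read the differing bits [al c] and [be c], so one point
       follows [p] and the other [q]. *)
    apply (block_word_limsup k (S c) (K1 + K2)); auto; intros j Hj; apply Rltb_true.
    specialize (Hr j).
    assert (far : forall x y, d (iter f j p) x < r / 3 -> d (iter f j q) y < r / 3 ->
              r / 3 < d x y).
    { intros x y Hx Hy; pose proof (tri (iter f j p) x (iter f j q)).
      pose proof (tri x y (iter f j q)) as Hxy; rewrite (sym y (iter f j q)) in Hxy; lra. }
    destruct (al c) eqn:Ea; destruct (be c) eqn:Eb; try (exfalso; congruence).
    + rewrite sym; apply far; [apply HK1|apply HK2]; intros l Hl;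
        unfold block_word; now rewrite Hj by lia.
    + apply far; [apply HK1|apply HK2]; intros l Hl;
        unfold block_word; now rewrite Hj by lia.
Qed.

Lemma coded_DC1 {X : Type} (d : X -> X -> R) (f : X -> X) (k : nat)
  (tau : (nat -> bool) -> X) (p q : X) :
  is_metric d -> continuous_map d f -> (1 <= k)%nat ->
  iter f k p = p -> iter f k q = q -> p <> q ->
  (forall s, iter f k (tau s) = tau (shift 1 s)) ->
  (forall e, 0 < e -> exists K, forall s,
      (forall l, (l < K)%nat -> s l = false) -> d p (tau s) < e) ->
  (forall e, 0 < e -> exists K, forall s,
      (forall l, (l < K)%nat -> s l = true) -> d q (tau s) < e) ->
  exhibits_DC1 d f.
Proof.
  intros Hd cf Hk Hp Hq Hpq Htau Hfalse Htrue.
  assert (H := block_word_DC1 d f k tau p q Hd cf Hk Hp Hq Hpq Htau Hfalse Htrue).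
  exists (fun x => exists al, x = tau (block_word al)); split.
  - intros [code Hcode].
    (* Distinct sequences give DC1 pairs, hence distinct points, so a code of the set would inject
       all binary sequences into [nat]. *)
    apply (cantor_diagonal (fun al => code (tau (block_word al)))); intros al be E.
    apply NNPP; intros Hab; apply (DC1_pair_neq _ _ _ _ Hd (H _ _ Hab)).
    apply Hcode; eauto.
  - intros x y [al ->] [be ->] Hxy; apply H; congruence.
Qed.

(** * A piecewise linear full shift *)

Definition clamp (t : R) : R := Rmax 0 (Rmin t 1).

Lemma clamp_bounds (t : R) : 0 <= clamp t <= 1.
Proof. unfold clamp, Rmax, Rmin; repeat destruct Rle_dec; lra. Qed.

Lemma clamp_id (t : R) : 0 <= t <= 1 -> clamp t = t.
Proof. unfold clamp, Rmax, Rmin; repeat destruct Rle_dec; lra. Qed.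

Lemma clamp_low (t : R) : t <= 0 -> clamp t = 0.
Proof. unfold clamp, Rmax, Rmin; repeat destruct Rle_dec; lra. Qed.

Lemma clamp_high (t : R) : 1 <= t -> clamp t = 1.
Proof. unfold clamp, Rmax, Rmin; repeat destruct Rle_dec; lra. Qed.

Lemma clamp_lipschitz (s t : R) : Rabs (clamp s - clamp t) <= Rabs (s - t).
Proof.
  unfold clamp, Rmax, Rmin, Rabs; repeat destruct Rle_dec; repeat destruct Rcase_abs; lra.
Qed.

(* Slope 3 on [0,1/3] and [2/3,1], so both are mapped onto [0,1]; the fixed points
   0 and 1 carry the constant words. *)
Definition zigzag (t : R) : R := 3 * t - 2 * clamp (3 * t - 1).

Lemma zigzag_lipschitz (s t : R) : Rabs (zigzag s - zigzag t) <= 9 * Rabs (s - t).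
Proof.
  pose proof (clamp_lipschitz (3 * s - 1) (3 * t - 1)) as H.
  replace (3 * s - 1 - (3 * t - 1)) with (3 * (s - t)) in H by ring.
  rewrite Rabs_mult, (Rabs_right 3) in H by lra.
  unfold zigzag.
  replace (3 * s - 2 * clamp (3 * s - 1) - (3 * t - 2 * clamp (3 * t - 1)))
    with (3 * (s - t) + (-2) * (clamp (3 * s - 1) - clamp (3 * t - 1))) by ring.
  eapply Rle_trans; [apply Rabs_triang|].
  rewrite !Rabs_mult, (Rabs_right 3), (Rabs_left (-2)) by lra; lra.
Qed.

Definition digit (b : bool) : R := if b then 2 / 3 else 0.

(** The point of the middle-thirds Cantor set whose ternary digits are 0 or 2 according to [s]. *)
Definition ternary (s : nat -> bool) : R := Series (fun i => digit (s i) * (1 / 3) ^ i).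

Lemma ex_ternary (s : nat -> bool) : ex_series (fun i => digit (s i) * (1 / 3) ^ i).
Proof.
  apply (ex_series_le (K := R_AbsRing) (V := R_CompleteNormedModule)
           _ (fun i => (1 / 3) ^ i)).
  - intros i; change (Rabs (digit (s i) * (1 / 3) ^ i) <= (1 / 3) ^ i).
    assert (0 < (1 / 3) ^ i) by (apply pow_lt; lra).
    rewrite Rabs_right; unfold digit; destruct (s i); lra.
  - apply ex_series_geom; rewrite Rabs_right; lra.
Qed.

Lemma ternary_bounds (s : nat -> bool) : 0 <= ternary s <= 1.
Proof.
  assert (H : forall b i, 0 <= digit b * (1 / 3) ^ i <= 2 / 3 * (1 / 3) ^ i).
  { intros b i; assert (0 < (1 / 3) ^ i) by (apply pow_lt; lra); unfold digit; destruct b; lra. }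
  assert (G : ex_series (fun i => (1 / 3) ^ i)) by (apply ex_series_geom; rewrite Rabs_right; lra).
  split; unfold ternary.
  - rewrite <- (Rmult_0_l (Series (fun i => (1 / 3) ^ i))), <- Series_scal_l.
    apply Series_le; [|apply ex_ternary]; intros i; rewrite Rmult_0_l; split; [lra|apply H].
  - apply Rle_trans with (Series (fun i => 2 / 3 * (1 / 3) ^ i)).
    + apply Series_le; [intros; apply H|].
      now apply (ex_series_scal_l (K := R_AbsRing) (2 / 3) (fun i => (1 / 3) ^ i)).
    + rewrite Series_scal_l, Series_geom; [lra|rewrite Rabs_right; lra].
Qed.

Lemma ternary_shift (s : nat -> bool) : ternary s = digit (s 0%nat) + 1 / 3 * ternary (shift 1 s).
Proof.
  unfold ternary; rewrite (Series_incr_1 _ (ex_ternary s)), <- Series_scal_l; simpl pow.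
  rewrite Rmult_1_r; f_equal; apply Series_ext; intros i; unfold shift; simpl; ring.
Qed.

(** The first digit decides the branch, [3 * t] or [3 * t - 2], and either branch deletes that
    digit. *)
Lemma zigzag_ternary (s : nat -> bool) : zigzag (ternary s) = ternary (shift 1 s).
Proof.
  rewrite ternary_shift; pose proof (ternary_bounds (shift 1 s)).
  unfold zigzag, digit; destruct (s 0%nat); [rewrite clamp_high|rewrite clamp_low]; lra.
Qed.

(** Each leading zero contracts by a factor 3; long constant words thus lie near the fixed point
    0. *)
Lemma ternary_zeros (K : nat) : forall s, (forall l, (l < K)%nat -> s l = false) ->
  ternary s <= (1 / 3) ^ K.
Proof.
  induction K as [|K IH]; intros s Hs; simpl.
  - apply ternary_bounds.
  - rewrite ternary_shift, Hs by lia; unfold digit.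
    assert (ternary (shift 1 s) <= (1 / 3) ^ K) by (apply IH; intros; apply Hs; lia); lra.
Qed.

Lemma ternary_ones (K : nat) : forall s, (forall l, (l < K)%nat -> s l = true) ->
  1 - (1 / 3) ^ K <= ternary s.
Proof.
  induction K as [|K IH]; intros s Hs; simpl.
  - pose proof (ternary_bounds s); lra.
  - rewrite ternary_shift, Hs by lia; unfold digit.
    assert (1 - (1 / 3) ^ K <= ternary (shift 1 s)) by (apply IH; intros; apply Hs; lia); lra.
Qed.

(** * Local surgery *)

(** Pointwise, because the maps glued in below are continuous only near the orbit points. *)
Definition cont_at {X Y : Type} (d : X -> X -> R) (d' : Y -> Y -> R) (f : X -> Y) (x : X) : Prop :=
  forall e, 0 < e -> exists del, 0 < del /\ forall y, d x y < del -> d' (f x) (f y) < e.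

Definition dR (s t : R) : R := Rabs (t - s).

Lemma cont_at_comp {X Y Z : Type} (dX : X -> X -> R) (dY : Y -> Y -> R) (dZ : Z -> Z -> R)
  (f : X -> Y) (g : Y -> Z) (x : X) :
  cont_at dX dY f x -> cont_at dY dZ g (f x) -> cont_at dX dZ (fun y => g (f y)) x.
Proof.
  intros Hf Hg e e0; destruct (Hg e e0) as [e' [e0' He']].
  destruct (Hf e' e0') as [del [del0 Hdel]]; exists del; auto.
Qed.

Lemma lipschitz_cont_at {X Y : Type} (dX : X -> X -> R) (dY : Y -> Y -> R) (f : X -> Y) (L : R) :
  0 < L -> (forall x y, dY (f x) (f y) <= L * dX x y) -> forall x, cont_at dX dY f x.
Proof.
  intros L0 H x e e0; exists (e / L); split; [now apply Rdiv_lt_0_compat|].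
  intros y Hy; apply Rle_lt_trans with (1 := H x y).
  apply Rmult_lt_compat_l with (r := L) in Hy; auto.
  replace (L * (e / L)) with e in Hy by (field; lra); lra.
Qed.

Lemma clamp_cont (t : R) : cont_at dR dR clamp t.
Proof.
  apply lipschitz_cont_at with 1; [lra|].
  intros x y; rewrite Rmult_1_l; apply clamp_lipschitz.
Qed.

Lemma zigzag_cont (t : R) : cont_at dR dR zigzag t.
Proof. apply lipschitz_cont_at with 9; [lra|]; intros; apply zigzag_lipschitz. Qed.

Lemma dist_lipschitz {X : Type} (d : X -> X -> R) (p x y : X) :
  is_metric d -> Rabs (d p y - d p x) <= d x y.
Proof.
  intros [pos [zero [sym tri]]]; apply Rabs_le.
  pose proof (tri p x y); pose proof (tri p y x); rewrite (sym y x) in *; lra.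
Qed.

(* Local equiconnectedness: this is all the surgery uses of the manifold structure. *)
Definition local_join {X : Type} (d : X -> X -> R) (W : X -> Prop) (e : R)
  (c : X -> X -> R -> X) : Prop :=
  (forall u v, W u -> W v -> c u v 0 = u /\ c u v 1 = v) /\
  (forall u v t, W u -> W v -> 0 <= t <= 1 -> d u (c u v t) < e) /\
  (forall u v t, W u -> W v -> 0 <= t <= 1 -> forall e', 0 < e' ->
     exists del, 0 < del /\ forall u' v' t', W u' -> W v' -> 0 <= t' <= 1 ->
       d u u' < del -> d v v' < del -> dR t t' < del -> d (c u v t) (c u' v' t') < e').

(** Slide from [f y] to [h y] along the join, with a bump function of [d p y] as parameter: 1 up to
    [r], 0 from [2 * r] on. *)
Lemma surgery {X : Type} (d : X -> X -> R) (f h : X -> X) (p : X) (r e : R)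
  (W : X -> Prop) (c : X -> X -> R -> X) :
  is_metric d -> continuous_map d f -> 0 < r -> 0 < e -> local_join d W e c ->
  (forall y, d p y < 3 * r -> W (f y) /\ W (h y) /\ cont_at d d h y) ->
  exists g, continuous_map d g /\
    (forall y, d p y <= r -> g y = h y) /\
    (forall y, 3 * r <= d p y -> g y = f y) /\
    (forall y, d (f y) (g y) < e).
Proof.
  intros Hd cf r0 e0 [Hends [Hshort Hcont]] Hball.
  set (lam y := clamp (2 - d p y / r)).
  assert (lam_cont : forall y, cont_at d dR lam y).
  { intros y; apply (cont_at_comp d dR dR); [|apply clamp_cont].
    apply lipschitz_cont_at with (/ r); [now apply Rinv_0_lt_compat|].
    intros x x'; unfold dR.
    replace (2 - d p x' / r - (2 - d p x / r)) with (/ r * - (d p x' - d p x)) by (field; lra).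
    assert (0 < / r) by now apply Rinv_0_lt_compat.
    rewrite Rabs_mult, Rabs_Ropp, (Rabs_right (/ r)) by lra.
    apply Rmult_le_compat_l; [lra|]; now apply dist_lipschitz. }
  assert (lam_far : forall y, 2 * r <= d p y -> lam y = 0).
  { intros y Hy; apply clamp_low.
    apply Rmult_le_reg_r with r; auto; unfold Rminus, Rdiv.
    rewrite Rmult_plus_distr_r, Ropp_mult_distr_l_reverse, Rmult_assoc, Rinv_l; lra. }
  assert (lam_near : forall y, d p y <= r -> lam y = 1).
  { intros y Hy; apply clamp_high.
    apply Rmult_le_reg_r with r; auto; unfold Rminus, Rdiv.
    rewrite Rmult_plus_distr_r, Ropp_mult_distr_l_reverse, Rmult_assoc, Rinv_l; lra. }
  destruct Hd as [pos [zero [sym tri]]].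
  (* The cut at [3 * r] lies beyond the support of [lam]: on the collar from [2 * r] to [3 * r] both
     formulas agree, which makes [g] continuous across the cut. *)
  set (g y := if Rlt_dec (d p y) (3 * r) then c (f y) (h y) (lam y) else f y).
  assert (g_in : forall y, d p y < 3 * r -> g y = c (f y) (h y) (lam y)).
  { intros y Hy; unfold g; destruct Rlt_dec; auto; lra. }
  assert (g_out : forall y, 2 * r <= d p y -> g y = f y).
  { intros y Hy; unfold g; destruct Rlt_dec as [H|]; auto.
    rewrite lam_far by auto; now apply Hends; apply Hball. }
  exists g; repeat split.
  - intros y a a0; destruct (Rlt_le_dec (d p y) (3 * r)) as [Hy|Hy].
    + destruct (Hball y Hy) as [Wf [Wh hc]].
      destruct (Hcont _ _ (lam y) Wf Wh (clamp_bounds _) a a0) as [del [del0 Hdel]].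
      destruct (cf y del del0) as [d1 [d10 Hd1]].
      destruct (hc del del0) as [d2 [d20 Hd2]].
      destruct (lam_cont y del del0) as [d3 [d30 Hd3]].
      exists (Rmin (Rmin d1 d2) (Rmin d3 (3 * r - d p y))); split.
      { repeat apply Rmin_pos; auto; lra. }
      intros y' Hy'.
      apply Rmin_Rgt in Hy'; destruct Hy' as [Hl Hr].
      apply Rmin_Rgt in Hl; apply Rmin_Rgt in Hr.
      assert (Hin : d p y' < 3 * r) by (specialize (tri p y y'); lra).
      destruct (Hball y' Hin) as [Wf' [Wh' _]].
      rewrite !g_in by auto; apply Hdel; auto; try apply clamp_bounds.
      * now apply Hd1.
      * now apply Hd2.
      * now apply Hd3.
    + destruct (cf y a a0) as [d1 [d10 Hd1]].
      exists (Rmin d1 r); split; [now apply Rmin_pos|].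
      intros y' Hy'; apply Rmin_Rgt in Hy'; destruct Hy' as [H1 H2].
      rewrite !g_out; [now apply Hd1| |lra].
      specialize (tri p y' y); rewrite (sym y' y) in tri; lra.
  - intros y Hy; rewrite g_in, lam_near by lra.
    assert (d p y < 3 * r) as H by lra; destruct (Hball y H) as [? [? _]]; now apply Hends.
  - intros y Hy; apply g_out; lra.
  - intros y; destruct (Rlt_le_dec (d p y) (3 * r)) as [Hy|Hy].
    + rewrite g_in by auto; destruct (Hball y Hy) as [? [? _]].
      apply Hshort; auto; apply clamp_bounds.
    + rewrite g_out, (proj2 (zero _ _) eq_refl) by lra; auto.
Qed.

(** The surgeries are done one at a time. Centres [6 * r] apart have disjoint [3 * r]-balls, so each
    surgery meets the original [f], preserves the earlier ones, and errors do not add up. The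
    induction carries the extra clause that [g = f] off the balls treated so far. *)
Lemma surgery_family {X : Type} (d : X -> X -> R) (f : X -> X) (h : nat -> X -> X)
  (p : nat -> X) (k : nat) (r e : R) :
  is_metric d -> continuous_map d f -> 0 < r -> 0 < e ->
  (forall i j, (i < k)%nat -> (j < k)%nat -> i <> j -> 6 * r <= d (p i) (p j)) ->
  (forall i, (i < k)%nat -> exists W c, local_join d W e c /\
     forall y, d (p i) y < 3 * r -> W (f y) /\ W (h i y) /\ cont_at d d (h i) y) ->
  exists g, continuous_map d g /\
    (forall i y, (i < k)%nat -> d (p i) y <= r -> g y = h i y) /\
    (forall y, d (f y) (g y) < e).
Proof.
  intros Hd cf r0 e0 Hsep Hloc.
  assert (H : forall m, (m <= k)%nat -> exists g, continuous_map d g /\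
    (forall i y, (i < m)%nat -> d (p i) y <= r -> g y = h i y) /\
    (forall y, d (f y) (g y) < e) /\
    (forall y, (forall i, (i < m)%nat -> 3 * r <= d (p i) y) -> g y = f y)).
  { induction m as [|m IH]; intros Hm.
    - exists f; repeat split; auto; [intros; lia|].
      intros y; destruct Hd as [_ [zero _]]; now rewrite (proj2 (zero _ _) eq_refl).
    - destruct IH as [g [cg [gh [ge gf]]]]; [lia|].
      destruct (Hloc m) as [W [c [HW Hball]]]; [lia|].
      assert (gfm : forall y, d (p m) y < 3 * r -> g y = f y).
      { intros y Hy; apply gf; intros i Hi.
        assert (6 * r <= d (p i) (p m)) by (apply Hsep; lia).
        destruct Hd as [_ [_ [sym tri]]].
        specialize (tri (p i) y (p m)); rewrite (sym y) in tri; lra. }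
      destruct (surgery d g (h m) (p m) r e W c) as [g' [cg' [near' [far' ge']]]]; auto.
      { intros y Hy; rewrite gfm by auto; auto. }
      exists g'; repeat split; auto.
      + intros i y Hi Hy; destruct (Nat.eq_dec i m) as [->|]; [now apply near'|].
        rewrite far'; [apply gh; auto; lia|].
        assert (6 * r <= d (p i) (p m)) by (apply Hsep; lia).
        destruct Hd as [_ [_ [sym tri]]].
        specialize (tri (p i) y (p m)); rewrite (sym y) in tri; lra.
      + intros y; destruct (Rlt_le_dec (d (p m) y) (3 * r)) as [Hy|Hy].
        * rewrite <- gfm by auto; apply ge'.
        * now rewrite far'.
      + intros y Hy; rewrite far' by (apply Hy; lia).
        apply gf; intros i Hi; apply Hy; lia. }
  destruct (H k (le_n k)) as [g [? [? [? _]]]]; now exists g.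
Qed.

(** * Short segments and arcs in charts *)

Lemma near_in_chart {X : Type} (d : X -> X -> R) (n : nat) (V : (nat -> R) -> Prop)
  (psi : (nat -> R) -> X) (v : nat -> R) (e : R) :
  open_in_halfspace n V -> V v -> 0 < e ->
  (forall e, 0 < e -> exists del, 0 < del /\
     forall w, V w -> near n del v w -> d (psi v) (psi w) < e) ->
  exists del, 0 < del /\ forall w, in_halfspace n w -> near n del v w ->
    V w /\ d (psi v) (psi w) < e.
Proof.
  intros [_ HV] Vv e0 Hpsi.
  destruct (HV v Vv) as [d1 [d10 H1]]; destruct (Hpsi e e0) as [d2 [d20 H2]].
  exists (Rmin d1 d2); split; [now apply Rmin_pos|].
  intros w Hw Hvw.
  assert (Vw : V w).
  { apply H1; auto; intros i Hi; apply Rlt_le_trans with (1 := Hvw i Hi), Rmin_l. }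
  split; auto; apply H2; auto.
  intros i Hi; apply Rlt_le_trans with (1 := Hvw i Hi), Rmin_r.
Qed.

Definition segment (v w : nat -> R) (t : R) : nat -> R := fun i => (1 - t) * v i + t * w i.

Lemma segment_halfspace (n : nat) (v w : nat -> R) (t : R) :
  in_halfspace n v -> in_halfspace n w -> 0 <= t <= 1 -> in_halfspace n (segment v w t).
Proof.
  unfold segment; intros [Hv Hv0] [Hw Hw0] Ht; split.
  - intros i Hi; rewrite Hv, Hw by auto; ring.
  - assert (0 <= (1 - t) * v 0%nat) by (apply Rmult_le_pos; lra).
    assert (0 <= t * w 0%nat) by (apply Rmult_le_pos; lra); lra.
Qed.

Lemma convex_abs_lt (t a b e : R) :
  0 <= t <= 1 -> Rabs a < e -> Rabs b < e -> Rabs ((1 - t) * a + t * b) < e.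
Proof.
  intros Ht Ha Hb; eapply Rle_lt_trans; [apply Rabs_triang|].
  rewrite !Rabs_mult, (Rabs_right t), (Rabs_right (1 - t)) by lra.
  destruct (Rlt_le_dec t (1 / 2)); nra.
Qed.

Lemma near_segment (n : nat) (e t : R) (x v w : nat -> R) :
  near n e x v -> near n e x w -> 0 <= t <= 1 -> near n e x (segment v w t).
Proof.
  intros Hv Hw Ht i Hi; unfold segment.
  replace ((1 - t) * v i + t * w i - x i) with ((1 - t) * (v i - x i) + t * (w i - x i)) by ring.
  apply convex_abs_lt; auto.
Qed.

(** The term [e] comes from moving the endpoints, [e * a] from moving the parameter along a segment
    of size [a]. *)
Lemma segment_continuous (n : nat) (t t' a e : R) (v w v' w' : nat -> R) :
  near n a v w -> 0 <= t' <= 1 ->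
  near n e v v' -> near n e w w' -> dR t t' < e ->
  near n (e + e * a) (segment v w t) (segment v' w' t').
Proof.
  intros Hvw Ht' Hv Hw Htt i Hi.
  specialize (Hvw i Hi); specialize (Hv i Hi); specialize (Hw i Hi); unfold segment, dR in *.
  replace ((1 - t') * v' i + t' * w' i - ((1 - t) * v i + t * w i))
    with (((1 - t') * (v' i - v i) + t' * (w' i - w i)) + (t' - t) * (w i - v i)) by ring.
  eapply Rle_lt_trans; [apply Rabs_triang|].
  apply Rplus_lt_compat.
  - now apply convex_abs_lt.
  - rewrite Rabs_mult; apply Rmult_le_0_lt_compat; auto using Rabs_pos.
Qed.

(** Half-spaces and coordinate boxes are convex, so straight chart segments between points near [z]
    stay in the chart and near [z]. *)
Lemma chart_local_join {X : Type} (d : X -> X -> R) (n : nat) (z : X) (e : R) :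
  is_metric d -> chart_at d n z -> 0 < e ->
  exists r c, 0 < r /\ local_join d (fun y => d z y < r) e c.
Proof.
  intros [pos [zero [sym tri]]]
    [U [V [phi [psi [oU [Uz [oV [UV [VU [psiphi [phipsi [cphi cpsi]]]]]]]]]]]] e0.
  destruct (near_in_chart d n V psi (phi z) (e / 2)) as [a [a0 Ha]]; auto; [lra|].
  rewrite psiphi in Ha by auto.
  destruct (oU z Uz) as [r1 [r10 Hr1]].
  destruct (cphi z Uz a a0) as [r2 [r20 Hr2]].
  exists (Rmin r1 r2), (fun u v t => psi (segment (phi u) (phi v) t)).
  split; [now apply Rmin_pos|].
  assert (WU : forall y, d z y < Rmin r1 r2 -> U y /\ near n a (phi z) (phi y)).
  { intros y Hy; apply Rmin_Rgt in Hy; destruct Hy; split; auto. }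
  assert (Hseg : forall u v t, d z u < Rmin r1 r2 -> d z v < Rmin r1 r2 -> 0 <= t <= 1 ->
    V (segment (phi u) (phi v) t) /\ d z (psi (segment (phi u) (phi v) t)) < e / 2).
  { intros u v t Hu Hv Ht; apply WU in Hu; apply WU in Hv.
    apply Ha; [apply segment_halfspace; auto; apply oV, UV; tauto|].
    apply near_segment; tauto. }
  assert (Hends : forall u v, d z u < Rmin r1 r2 -> d z v < Rmin r1 r2 ->
    psi (segment (phi u) (phi v) 0) = u /\ psi (segment (phi u) (phi v) 1) = v).
  { intros u v Hu Hv; apply WU in Hu; apply WU in Hv.
    split; [rewrite <- (psiphi u) at 2 by tauto|rewrite <- (psiphi v) at 2 by tauto]; f_equal;
      apply functional_extensionality; intros i; unfold segment; ring. }
  split; [exact Hends|split].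
  - intros u v t Hu Hv Ht.
    destruct (Hseg u v t Hu Hv Ht) as [_ H1].
    destruct (Hseg u v 0 Hu Hv ltac:(lra)) as [_ H2].
    rewrite (proj1 (Hends u v Hu Hv)) in H2.
    specialize (tri u z (psi (segment (phi u) (phi v) t))); rewrite (sym u z) in tri; lra.
  - intros u v t Hu Hv Ht e' e0'.
    destruct (Hseg u v t Hu Hv Ht) as [H1 _].
    destruct (cpsi _ H1 e' e0') as [b [b0 Hb]].
    assert (Hdiam : near n (2 * a) (phi u) (phi v)).
    { apply WU in Hu; apply WU in Hv; intros i Hi.
      pose proof (proj2 Hu i Hi) as Hu'; pose proof (proj2 Hv i Hi) as Hv'.
      apply Rabs_def2 in Hu'; apply Rabs_def2 in Hv'; apply Rabs_def1; lra. }
    (* Chosen so that [b' + b' * (2 * a) = b], the bound of [segment_continuous] for segments of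
       size [2 * a]. *)
    set (b' := b / (1 + 2 * a)).
    assert (b0' : 0 < b') by (apply Rdiv_lt_0_compat; lra).
    destruct (cphi u (proj1 (WU u Hu)) b' b0') as [d1 [d10 Hd1]].
    destruct (cphi v (proj1 (WU v Hv)) b' b0') as [d2 [d20 Hd2]].
    exists (Rmin b' (Rmin d1 d2)); split; [repeat apply Rmin_pos; auto|].
    intros u' v' t' Hu' Hv' Ht' Hdu Hdv Hdt.
    apply Rmin_Rgt in Hdu; apply Rmin_Rgt in Hdv; apply Rmin_Rgt in Hdt.
    destruct Hdu as [_ Hdu]; apply Rmin_Rgt in Hdu.
    destruct Hdv as [_ Hdv]; apply Rmin_Rgt in Hdv.
    apply Hb; [now apply Hseg|].
    replace b with (b' + b' * (2 * a)) by (unfold b'; field; lra).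
    apply segment_continuous; auto; try tauto.
    + apply Hd1; [now apply WU|tauto].
    + apply Hd2; [now apply WU|tauto].
Qed.

(** Coordinate 0 is the one constrained in the half-space; increasing it never leaves the
    half-space, so boundary points get arcs too. *)
Definition push (v : nat -> R) (s : R) : nat -> R :=
  fun i => match i with O => v 0%nat + s | S _ => v i end.

Lemma push_halfspace (n : nat) (v : nat -> R) (s : R) :
  (1 <= n)%nat -> in_halfspace n v -> 0 <= s -> in_halfspace n (push v s).
Proof.
  intros Hn [Hv Hv0] Hs; split; [|simpl; lra].
  intros [|i] Hi; [lia|]; now apply Hv.
Qed.

Lemma near_push (n : nat) (v : nat -> R) (s s' e : R) :
  0 < e -> Rabs (s' - s) < e -> near n e (push v s) (push v s').
Proof.
  intros e0 H [|i] Hi; simpl.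
  - replace (v 0%nat + s' - (v 0%nat + s)) with (s' - s) by ring; auto.
  - now rewrite Rminus_diag, Rabs_R0.
Qed.

Lemma push_0 (v : nat -> R) : push v 0 = v.
Proof. apply functional_extensionality; intros [|i]; simpl; [ring|reflexivity]. Qed.

(** The arc pushes [x] along coordinate 0, and [T] is that coordinate, rescaled and clamped. The
    radius [r] precedes [e]: arcs may be shortened after the domain of [T] is fixed. *)
Lemma chart_arc {X : Type} (d : X -> X -> R) (n : nat) (x : X) :
  (1 <= n)%nat -> chart_at d n x ->
  exists r, 0 < r /\ forall e, 0 < e -> exists (a : R -> X) (T : X -> R),
    (forall t, cont_at dR d a t) /\ (forall t, d x (a t) < e) /\
    (forall y, d x y < r -> cont_at d dR T y) /\
    (forall t, 0 <= t <= 1 -> T (a t) = t).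
Proof.
  intros Hn [U [V [phi [psi [oU [Ux [oV [UV [VU [psiphi [phipsi [cphi cpsi]]]]]]]]]]]].
  destruct (oU x Ux) as [r [r0 Hr]].
  exists r; split; auto; intros e e0.
  destruct (near_in_chart d n V psi (phi x) e) as [b [b0 Hb]]; auto.
  rewrite psiphi in Hb by auto.
  set (w t := push (phi x) (b / 2 * clamp t)).
  assert (Hw : forall t, V (w t) /\ d x (psi (w t)) < e).
  { intros t; pose proof (clamp_bounds t) as Ht; apply Hb.
    - apply push_halfspace; auto; [apply oV, UV, Ux|nra].
    - rewrite <- (push_0 (phi x)) at 1; apply near_push; auto.
      rewrite Rabs_right by nra; nra. }
  exists (fun t => psi (w t)), (fun y => clamp ((phi y 0%nat - phi x 0%nat) / (b / 2))).
  repeat split.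
  - intros t e' e0'.
    destruct (cpsi (w t) (proj1 (Hw t)) e' e0') as [b' [b0' Hb']].
    exists (b' / (b / 2)); split; [apply Rdiv_lt_0_compat; lra|].
    intros t' Ht'; apply Hb'; [apply Hw|]; apply near_push; auto.
    replace (b / 2 * clamp t' - b / 2 * clamp t) with (b / 2 * (clamp t' - clamp t)) by ring.
    rewrite Rabs_mult, Rabs_right by lra.
    apply Rle_lt_trans with (b / 2 * dR t t').
    + apply Rmult_le_compat_l; [lra|apply clamp_lipschitz].
    + apply Rmult_lt_compat_l with (r := b / 2) in Ht'; [|lra].
      replace (b / 2 * (b' / (b / 2))) with b' in Ht' by (field; lra); lra.
  - apply Hw.
  - intros y Hy; apply (cont_at_comp d dR dR); [|apply clamp_cont].
    intros e' e0'; destruct (cphi y (Hr y Hy) (e' * (b / 2))) as [del [del0 Hdel]].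
    { apply Rmult_lt_0_compat; lra. }
    destruct (oU y (Hr y Hy)) as [s [s0 Hs]].
    exists (Rmin del s); split; [now apply Rmin_pos|].
    intros y' Hy'; apply Rmin_Rgt in Hy'; destruct Hy' as [H1 H2].
    specialize (Hdel y' (Hs y' H2) H1 0%nat ltac:(lia)); unfold dR.
    replace ((phi y' 0%nat - phi x 0%nat) / (b / 2) - (phi y 0%nat - phi x 0%nat) / (b / 2))
      with ((phi y' 0%nat - phi y 0%nat) * / (b / 2)) by (field; lra).
    assert (0 < / (b / 2)) by (apply Rinv_0_lt_compat; lra).
    rewrite Rabs_mult, (Rabs_right (/ (b / 2))) by lra.
    apply Rmult_lt_reg_r with (b / 2); [lra|].
    rewrite Rmult_assoc, Rinv_l by lra; lra.
  - intros t Ht; rewrite phipsi by apply Hw; unfold w; simpl.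
    replace ((phi x 0%nat + b / 2 * clamp t - phi x 0%nat) / (b / 2)) with (clamp t)
      by (field; lra).
    rewrite !clamp_id; auto using clamp_bounds.
Qed.

(** * The perturbed map *)

(** With [k] the least positive return time, [iter f i y = iter f j y] for [i < j < k] would allow
    cutting out the loop and returning at the earlier time [k - j + i]. *)
Lemma first_return {X : Type} (d : X -> X -> R) (f : X -> X) (z : X) (r : R) (x : X) :
  (forall N, exists n, (N <= n)%nat /\ d z (iter f n x) < r) ->
  exists y k, (1 <= k)%nat /\ d z y < r /\ d z (iter f k y) < r /\
    forall i j, (i < j < k)%nat -> iter f i y <> iter f j y.
Proof.
  intros H; destruct (H 0%nat) as [n [_ Hn]].
  set (y := iter f n x) in *.
  assert (Hex : exists k, (1 <= k)%nat /\ d z (iter f k y) < r).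
  { destruct (H (S n)) as [m [Hm Hd]]; exists (m - n)%nat; split; [lia|].
    unfold y; rewrite <- iter_add; now replace (m - n + n)%nat with m by lia. }
  destruct (dec_inh_nat_subset_has_unique_least_element
              (fun k => (1 <= k)%nat /\ d z (iter f k y) < r)) as [k [[[Hk Hd] Hmin] _]];
    [intros; apply classic|assumption|].
  exists y, k; repeat split; auto.
  intros i j [Hij Hjk] E.
  assert (k <= k - j + i)%nat; [|lia].
  apply Hmin; split; [lia|].
  rewrite iter_add, E, <- iter_add; now replace (k - j + j)%nat with k by lia.
Qed.

Definition cyclic_succ (k i : nat) : nat := if Nat.eq_dec (S i) k then 0%nat else S i.

Lemma almost_periodic_orbit {X : Type} (d : X -> X -> R) (n : nat) (f : X -> X) (e : R) :
  is_metric d -> compact_space d -> is_manifold d n -> (exists x0 : X, True) ->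
  continuous_map d f -> 0 < e ->
  exists x k, (1 <= k)%nat /\ (forall i j, (i < j < k)%nat -> iter f i x <> iter f j x) /\
    forall i, (i < k)%nat -> exists W c r, 0 < r /\ local_join d W e c /\
      (forall y, d (iter f i x) y < r -> W (f y)) /\
      (forall y, d (iter f (cyclic_succ k i) x) y < r -> W y).
Proof.
  intros Hd cpt man [x0 _] cf e0.
  destruct (orbit_cluster_point d (fun i => iter f i x0) Hd cpt) as [z Hz].
  destruct (chart_local_join d n z e Hd (man z) e0) as [r [c [r0 Hc]]].
  destruct (first_return d f z r x0 (Hz r r0)) as [x [k [Hk [Hx [Hfx Hdist]]]]].
  assert (ball : forall z r y, d z y < r -> exists s, 0 < s /\ forall y', d y y' < s -> d z y' < r).
  { intros z' r' y Hy; exists (r' - d z' y); split; [lra|]; intros y' Hy'.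
    destruct Hd as [_ [_ [_ tri]]]; specialize (tri z' y y'); lra. }
  exists x, k; repeat split; auto; intros i Hi.
  (* Only the last index uses the ball around the cluster point, holding both [iter f k x] and [x];
     elsewhere [f] already hits the next orbit point, and a chart there suffices. *)
  assert (Hloc : exists z r c, local_join d (fun y => d z y < r) e c /\
    d z (iter f (S i) x) < r /\ d z (iter f (cyclic_succ k i) x) < r).
  { unfold cyclic_succ; destruct Nat.eq_dec as [->|Hne].
    - now exists z, r, c.
    - destruct (chart_local_join d n (iter f (S i) x) e Hd (man _) e0) as [r' [c' [r0' Hc']]].
      exists (iter f (S i) x), r', c'; split; auto.
      destruct Hd as [_ [zero _]]; now rewrite (proj2 (zero _ _) eq_refl). }
  clear z r c r0 Hc Hz Hx Hfx; destruct Hloc as [z [r [c [Hc [H1 H2]]]]].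
  destruct (ball _ _ _ H1) as [s1 [s10 Hs1]]; destruct (ball _ _ _ H2) as [s2 [s20 Hs2]].
  destruct (cf (iter f i x) s1 s10) as [s3 [s30 Hs3]].
  exists (fun y => d z y < r), c, (Rmin s2 s3); split; [now apply Rmin_pos|].
  split; [exact Hc|split]; intros y Hy; apply Rmin_Rgt in Hy; [apply Hs1, Hs3|apply Hs2]; tauto.
Qed.

(** On the arc [a 0], [iter g k] acts as [zigzag], so the Cantor set codes a full shift with fixed
    endpoints 0 and 1. [T] keeps the two endpoints of the arc distinct. *)
Lemma arc_horseshoe_DC1 {X : Type} (d : X -> X -> R) (g : X -> X) (k : nat)
  (a : nat -> R -> X) (T : X -> R) :
  is_metric d -> continuous_map d g -> (1 <= k)%nat ->
  cont_at dR d (a 0%nat) 0 -> cont_at dR d (a 0%nat) 1 ->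
  (forall t, 0 <= t <= 1 -> T (a 0%nat t) = t) ->
  (forall i t, (S i < k)%nat -> 0 <= t <= 1 -> g (a i t) = a (S i) t) ->
  (forall t, 0 <= t <= 1 -> g (a (k - 1)%nat t) = a 0%nat (zigzag t)) ->
  exhibits_DC1 d g.
Proof.
  intros Hd cg Hk c0 c1 HT Hstep Hlast.
  assert (Hiter : forall i t, (i < k)%nat -> 0 <= t <= 1 -> iter g i (a 0%nat t) = a i t).
  { induction i as [|i IH]; intros t Hi Ht; simpl; auto.
    rewrite IH by (auto; lia); now apply Hstep. }
  assert (Hret : forall t, 0 <= t <= 1 -> iter g k (a 0%nat t) = a 0%nat (zigzag t)).
  { intros t Ht; rewrite <- (Hlast t Ht), <- (Hiter (k - 1)%nat t) by (auto; lia).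
    now replace k with (S (k - 1)) at 1 by lia. }
  assert (small : forall e, 0 < e -> exists K, (1 / 3) ^ K < e).
  { intros e e0; destruct (pow_lt_1_zero (1 / 3)) with (y := e) as [K HK]; auto.
    - rewrite Rabs_right; lra.
    - exists K; specialize (HK K (le_n K)).
      rewrite Rabs_right in HK; auto; left; apply Rlt_gt, pow_lt; lra. }
  apply (coded_DC1 d g k (fun s => a 0%nat (ternary s)) (a 0%nat 0) (a 0%nat 1)); auto.
  - rewrite Hret by lra; f_equal; unfold zigzag; rewrite clamp_low; lra.
  - rewrite Hret by lra; f_equal; unfold zigzag; rewrite clamp_high; lra.
  - intros E; apply (f_equal T) in E; rewrite !HT in E; lra.
  - intros s; now rewrite Hret, zigzag_ternary by apply ternary_bounds.
  - intros e e0; destruct (c0 e e0) as [b [b0 Hb]]; destruct (small b b0) as [K HK].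
    exists K; intros s Hs; apply Hb; unfold dR.
    pose proof (ternary_bounds s); pose proof (ternary_zeros K s Hs).
    rewrite Rabs_right; lra.
  - intros e e0; destruct (c1 e e0) as [b [b0 Hb]]; destruct (small b b0) as [K HK].
    exists K; intros s Hs; apply Hb; unfold dR.
    pose proof (ternary_bounds s); pose proof (ternary_ones K s Hs).
    rewrite Rabs_left1; lra.
Qed.

Lemma DC1_approximation {X : Type} (d : X -> X -> R) (n : nat) (f : X -> X) (e : R) :
  is_metric d -> compact_space d -> (1 <= n)%nat -> is_manifold d n ->
  (exists x0 : X, True) -> continuous_map d f -> 0 < e ->
  exists g, continuous_map d g /\ exhibits_DC1 d g /\ forall y, d (f y) (g y) < e.
Proof.
  intros Hd cpt Hn man Hne cf e0.
  destruct (almost_periodic_orbit d n f e Hd cpt man Hne cf e0) as [x [k [Hk [Hdist Hloc]]]].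
  set (p i := iter f i x) in *.
  (* One radius for the whole orbit: [3 * r] bounds the surgery balls, [6 * r] keeps them disjoint,
     and [r] bounds the arcs. Separation is asked for [j < i] only; symmetry gives the rest. *)
  destruct (finite_pos (fun i r => (exists W c, local_join d W e c /\
      (forall y, d (p i) y < 3 * r -> W (f y)) /\
      (forall y, d (p (cyclic_succ k i)) y < r -> W y)) /\
      (forall j, (j < i)%nat -> 6 * r <= d (p j) (p i)) /\
      forall e, 0 < e -> exists (a : R -> X) (T : X -> R),
        (forall t, cont_at dR d a t) /\ (forall t, d (p i) (a t) < e) /\
        (forall y, d (p i) y < 3 * r -> cont_at d dR T y) /\
        (forall t, 0 <= t <= 1 -> T (a t) = t)) k) as [r [r0 Hr]].
  - intros i r r' [[W [c [H1 [H2 H3]]]] [H4 H5]] r0 Hle; split; [|split].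
    + exists W, c; split; [auto|split]; intros y Hy; [apply H2|apply H3]; lra.
    + intros j Hj; specialize (H4 j Hj); lra.
    + intros e' e0'; destruct (H5 e' e0') as [a [T [A1 [A2 [A3 A4]]]]].
      exists a, T; repeat split; auto; intros y Hy; apply A3; lra.
  - intros i Hi.
    destruct (Hloc i Hi) as [W [c [r1 [r10 [H1 [H2 H3]]]]]].
    destruct (finite_pos (fun j s => s <= d (p j) (p i)) i) as [r2 [r20 Hr2]].
    { intros; lra. }
    { intros j Hj; exists (d (p j) (p i)); split; [|lra].
      destruct Hd as [pos [zero _]]; destruct (pos (p j) (p i)) as [|E]; auto.
      exfalso; apply (Hdist j i); [lia|]; now apply zero. }
    destruct (chart_arc d n (p i) Hn (man _)) as [r3 [r30 Hr3]].
    set (r := Rmin (r1 / 3) (Rmin (r2 / 6) (r3 / 3))).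
    assert (r <= r1 / 3) by apply Rmin_l.
    assert (r <= r2 / 6) by (eapply Rle_trans; [apply Rmin_r|apply Rmin_l]).
    assert (r <= r3 / 3) by (eapply Rle_trans; [apply Rmin_r|apply Rmin_r]).
    exists r; split; [repeat apply Rmin_pos; lra|split; [|split]].
    + exists W, c; split; [auto|split]; intros y Hy; [apply H2|apply H3];
        apply Rlt_le_trans with (1 := Hy); lra.
    + intros j Hj; specialize (Hr2 j Hj); lra.
    + intros e' e0'; destruct (Hr3 e' e0') as [a [T [A1 [A2 [A3 A4]]]]].
      exists a, T; repeat split; auto; intros y Hy; apply A3; lra.
  - assert (Harc : forall i, exists aT : (R -> X) * (X -> R), (i < k)%nat ->
      (forall t, cont_at dR d (fst aT) t) /\ (forall t, d (p i) (fst aT t) < r) /\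
      (forall y, d (p i) y < 3 * r -> cont_at d dR (snd aT) y) /\
      (forall t, 0 <= t <= 1 -> snd aT (fst aT t) = t)).
    (* Indices from [k] on get a dummy pair, so that choice yields total families. *)
    { intros i; destruct (lt_dec i k) as [Hi|]; [|now exists (fun _ => x, fun _ => 0)].
      destruct (Hr i Hi) as [_ [_ H]]; destruct (H r r0) as [a [T HaT]].
      now exists (a, T). }
    apply functional_choice in Harc; destruct Harc as [aT HaT].
    set (a i := fst (aT i)); set (T i := snd (aT i)).
    (* The horseshoe enters once per cycle, at the closing step, so that [k] steps of [g] amount to
       one [zigzag]. *)
    set (F i := if Nat.eq_dec (S i) k then zigzag else fun t => t).
    assert (cF : forall i t, cont_at dR dR (F i) t).
    { intros i t; unfold F; destruct Nat.eq_dec; [apply zigzag_cont|].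
      intros e' e0'; now exists e'. }
    assert (Hsucc : forall i, (i < k)%nat -> (cyclic_succ k i < k)%nat).
    { intros i Hi; unfold cyclic_succ; destruct Nat.eq_dec; lia. }
    destruct (surgery_family d f (fun i y => a (cyclic_succ k i) (F i (T i y))) p k r e)
      as [g [cg [gh ge]]]; auto.
    + intros i j Hi Hj Hij; destruct (lt_dec i j).
      * apply (Hr j Hj); auto.
      * destruct Hd as [_ [_ [sym _]]]; rewrite sym; apply (Hr i Hi); lia.
    + intros i Hi; destruct (Hr i Hi) as [[W [c [H1 [H2 H3]]]] _].
      exists W, c; split; auto; intros y Hy; split; [auto|split].
      * apply H3, (HaT _ (Hsucc i Hi)).
      * apply (cont_at_comp d dR d); [|apply (HaT _ (Hsucc i Hi))].
        apply (cont_at_comp d dR dR); [now apply (HaT i Hi)|apply cF].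
    + assert (Hg : forall i t, (i < k)%nat -> 0 <= t <= 1 ->
        g (a i t) = a (cyclic_succ k i) (F i t)).
      { intros i t Hi Ht; destruct (HaT i Hi) as [_ [A2 [_ A4]]].
        (* The arc lies within [r] of [p i], where [g] is exactly the glued map, and [T i] recovers
           [t]. *)
        rewrite (gh i) by (auto; left; apply A2); f_equal; f_equal; now apply A4. }
      exists g; split; [auto|split; [|auto]].
      destruct (HaT 0%nat Hk) as [A1 [_ [_ A4]]].
      apply (arc_horseshoe_DC1 d g k a (T 0%nat)); auto; try apply A1.
      * intros i t Hi Ht; rewrite Hg by (auto; lia); unfold cyclic_succ, F.
        destruct Nat.eq_dec; [lia|reflexivity].
      * intros t Ht; rewrite Hg by (auto; lia); unfold cyclic_succ, F.
        destruct Nat.eq_dec; [reflexivity|lia].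
Qed.

Theorem theorem1p1 (X : Type) (d : X -> X -> R) (n : nat) :
  is_metric d -> compact_space d -> (1 <= n)%nat -> is_manifold d n ->
  (exists x0 : X, True) ->
  forall f : X -> X, continuous_map d f ->
  forall eps, 0 < eps ->
  exists g : X -> X, continuous_map d g /\ exhibits_DC1 d g /\
    exists s, is_dC0 d f g s /\ s < eps.
Proof.
  intros Hd cpt Hn man Hne f cf eps eps0.
  (* A strict pointwise bound only bounds the supremum weakly; halving [eps] restores strictness. *)
  destruct (DC1_approximation d n f (eps / 2)) as [g [cg [DC Hg]]]; auto; [lra|].
  exists g; split; [auto|split; [auto|]].
  assert (Hub : is_upper_bound (fun r => exists x, r = d (f x) (g x)) (eps / 2)).
  { intros r [x ->]; left; apply Hg. }
  destruct (completeness (fun r => exists x, r = d (f x) (g x))) as [s Hs].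
  - now exists (eps / 2).
  - destruct Hne as [x _]; now exists (d (f x) (g x)), x.
  - exists s; split; [exact Hs|].
    apply Hs in Hub; lra.
Qed.
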